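(* Let $r,m$ be positive integers and put $R=\mathbf{C}[[z]]/(z^{r^2m})$. Let $V,W$ be free $R$-modules of rank $r$ with connections $\nabla^V:V\to V\otimes\frac{dz}{z^m}$, $\nabla^W:W\to W\otimes\frac{dz}{z^m}$ and filtrations $$V=V_0\supset V_1\supset\cdots\supset V_{r-1}\supset V_r=0,\qquad W=W_0\supset W_1\supset\cdots\supset W_{r-1}\supset W_r=0$$ such that $V_i/V_{i+1}\cong R$, $W_i/W_{i+1}\cong R$, $\nabla^V(V_i)\subset V_i\otimes dz/z^m$ and $\nabla^W(W_i)\subset W_i\otimes dz/z^m$ for any $i$. Let $\nabla^V_i$ on $V_i/V_{i+1}$ and $\nabla^W_i$ on $W_i/W_{i+1}$ be the induced connections. Choose a basis $e^V_i$ of $V_i/V_{i+1}$ (resp. $e^W_i$ of $W_i/W_{i+1}$) such that $\nabla^V_i(e^V_i)=\nu^V_ie^V_i$ and $\nabla^W_i(e^W_i)=\nu^W_ie^W_i$ with $$\nu^V_i=\big(a^{(i)}_{-m}z^{-m}+\cdots+a^{(i)}_{-1}z^{-1}\big)dz,\qquad \nu^W_i=\big(b^{(i)}_{-m}z^{-m}+\cdots+b^{(i)}_{-1}z^{-1}\big)dz,$$ where $a^{(i)}_k,b^{(i)}_k\in\mathbf{C}$. Assume that $0\le\mathrm{Re}(a^{(i)}_{-1})<1$ and $0\le\mathrm{Re}(b^{(i)}_{-1})<1$ for any $i$. If there is an isomorphism $\varphi:V\to W$ of $R$-modules such that $\nabla^W\circ\varphi=(\varphi\otimes\mathrm{id})\circ\nabla^V$,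 then there is a permutation $\sigma$ of $\{0,\dots,r-1\}$ such that $\nu^V_i=\nu^W_{\sigma(i)}$ for any $i=0,\dots,r-1$.
   Context: $V\otimes\frac{dz}{z^m}$ denotes $V\otimes_R R\frac{dz}{z^m}$, with $R\frac{dz}{z^m}$ the free rank one $R$-module on the symbol $dz/z^m$; $z^kdz$ for $k\ge-m$ means $z^{k+m}\cdot\frac{dz}{z^m}$. The derivation $d:R\to R\frac{dz}{z^m}$, $f\mapsto z^mf'(z)\frac{dz}{z^m}$, is well defined because $m\ge1$. A connection is a $\mathbf{C}$-linear map $\nabla:V\to V\otimes\frac{dz}{z^m}$ with $\nabla(fv)=v\otimes df+f\nabla(v)$ for $f\in R$, $v\in V$. The equality $\nu^V_i=\nu^W_{\sigma(i)}$ means equality of all the coefficients. *)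

(* Defs.v *)
From HB Require Import structures.
From mathcomp Require Import all_boot all_order all_algebra.
From mathcomp Require Import qpoly generic_quotient ring_quotient complex reals.

Set Implicit Arguments.
Unset Strict Implicit.
Unset Printing Implicit Defensive.

Import GRing.Theory Pdiv.RingMonic.
Local Open Scope ring_scope.
Local Open Scope quotient_scope.

(* K[[z]]/(z^N), as the library quotient K[X]/(X^N). The lemmas tps_of_series_*
   below identify it with the quotient of the power series (coefficient sequences
   nat -> K with the Cauchy product) by the ideal generated by z^N. For N = 0 the
   library quotient is by X, so only 0 < N is meaningful. *)
Notation tps K N := {poly %/ ('X^N : {poly K})}.

Section TruncatedPowerSeries.
Variables (K : comNzRingType) (N : nat).

Definition tps_const (c : K) : tps K N := qpolyC _ c.
Definition tps_z : tps K N := in_qpoly _ 'X.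
Definition tps_of_series (f : nat -> K) : tps K N := in_qpoly _ (\poly_(i < N) f i).

Hypothesis N_gt0 : (0 < N)%N.

Lemma mk_monic_XN : mk_monic ('X^N : {poly K}) = 'X^N.
Proof. by case: N N_gt0 => // n _; rewrite mk_monic_Xn. Qed.

Lemma in_qpolyXN p i : (in_qpoly ('X^N : {poly K}) p : {poly K})`_i =
  if (i < N)%N then p`_i else 0.
Proof.
rewrite /= mk_monic_XN; have mX := monicXn K N.
rewrite -[p in LHS](poly_take_drop N) addrC rmodp_addl_mul_small //.
  by rewrite coef_take_poly.
by rewrite size_polyXn ltnS size_take_poly.
Qed.

Lemma tps_of_series_surj (x : tps K N) : exists f, tps_of_series f = x.
Proof.
exists (fun i => (x : {poly K})`_i).
apply: val_inj; apply/polyP => i; rewrite in_qpolyXN coef_poly.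
case: ltnP => // le_Ni; rewrite nth_default //.
by apply: leq_trans (size_npoly x) _; rewrite mk_monic_XN size_polyXn.
Qed.

Lemma tps_of_series_eq f g :
  tps_of_series f = tps_of_series g <-> forall i, (i < N)%N -> f i = g i.
Proof.
split=> [fg i lt_iN | fg].
  have := congr1 (fun x : tps K N => (x : {poly K})`_i) fg.
  by rewrite !in_qpolyXN !coef_poly lt_iN.
apply: val_inj; apply/polyP => i; rewrite !in_qpolyXN !coef_poly.
by case: ltnP => // /fg.
Qed.

Lemma tps_of_series_add (f g : nat -> K) :
  tps_of_series (fun i => f i + g i) = tps_of_series f + tps_of_series g.
Proof.
rewrite /tps_of_series -in_qpolyD; congr in_qpoly; apply/polyP => i.
by rewrite coefD !coef_poly; case: ifP; rewrite ?addr0.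
Qed.

Lemma tps_of_series_mul (f g : nat -> K) :
  tps_of_series (fun n => \sum_(j < n.+1) f j * g (n - j)%N) =
  tps_of_series f * tps_of_series g.
Proof.
rewrite /tps_of_series -in_qpolyM; apply: val_inj; apply/polyP => i.
rewrite !in_qpolyXN; case: ltnP => // lt_iN; rewrite coefM coef_poly lt_iN.
apply: eq_bigr => j _; rewrite !coef_poly.
have -> : (j < N)%N by apply: leq_ltn_trans lt_iN; rewrite -ltnS.
by rewrite (leq_ltn_trans (leq_subr _ _) lt_iN).
Qed.

End TruncatedPowerSeries.

(* The free rank one module on the symbol dz/z^m; the form f . (dz/z^m) is
   represented by f. *)
Definition form (K : comNzRingType) (N m : nat) : Type := (tps K N)^o.
HB.instance Definition _ K N m := GRing.Lmodule.on (form K N m).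

(* z^(-k) dz = z^(m-k) . (dz/z^m), for k <= m. *)
Definition polar_dz (K : comNzRingType) (N m k : nat) : form K N m :=
  tps_z K N ^+ (m - k).

(* d f = z^m f'(z) . (dz/z^m), computed on the polynomial representing f. *)
Definition tps_d (K : comNzRingType) (N m : nat) (f : tps K N) : form K N m :=
  in_qpoly ('X^N : {poly K}) ('X^m * (f : {poly K})^`()).

Lemma tps_dE (K : comNzRingType) (N m : nat) (p : {poly K}) :
  (0 < N)%N -> (0 < m)%N ->
  tps_d m (in_qpoly 'X^N p) = in_qpoly 'X^N ('X^m * p^`()) :> tps K N.
Proof.
move=> N_gt0 m_gt0; apply: val_inj; apply/polyP => i.
rewrite !in_qpolyXN //; case: ltnP => // lt_iN; rewrite !coefXnM.
case: ltnP => // le_mi; rewrite !coef_deriv in_qpolyXN //.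
have -> : ((i - m).+1 < N)%N; last by [].
by apply: leq_ltn_trans lt_iN; rewrite -subSn // leq_subLR -add1n leq_add2r.
Qed.

(* V (x) dz/z^m, with v (x) (f . (dz/z^m)) represented by f *: v; the universal
   property is tensP. *)
Definition twist (K : comNzRingType) (N m : nat) (V : lmodType (tps K N)) : Type := V.
HB.instance Definition _ K N m V := GRing.Lmodule.on (@twist K N m V).

Section Connections.
Variables (K : comNzRingType) (N m : nat).
Local Notation A := (tps K N).
Implicit Types V W : lmodType A.

Definition tens V (v : V) (w : form K N m) : twist m V := (w : A) *: v.

Lemma tensP V (P : lmodType A) (b : V -> form K N m -> P) :
  (forall w, linear (b^~ w)) -> (forall v, linear (b v)) ->
  exists! g : twist m V -> P, linear g /\ forall v w, g (tens v w) = b v w.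
Proof.
move=> bl br; exists (fun x => b x (1 : A)); split.
  split=> [a x y|v w]; first exact: bl.
  have b0 : b 0 (1 : A) = 0.
    have := bl (1 : A) (1 : A) 0 0; rewrite !scale1r addr0 => /eqP.
    by rewrite -subr_eq0 opprD addrA subrr sub0r oppr_eq0 => /eqP.
  have b0r : b v 0 = 0.
    have := br v (1 : A) 0 0; rewrite !scale1r addr0 => /eqP.
    by rewrite -subr_eq0 opprD addrA subrr sub0r oppr_eq0 => /eqP.
  have := bl (1 : A) (w : A) v 0; rewrite addr0 b0 addr0 => ->.
  have := br v (w : A) (1 : A) 0; rewrite addr0 b0r addr0 => <-.
  by congr (b v _); rewrite /GRing.scale /= mulr1.
move=> g [_ gE]; apply: boolp.funext => x.
by rewrite -gE /tens scale1r.
Qed.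

(* phi (x) id. *)
Definition twist_map V W (phi : V -> W) : twist m V -> twist m W := phi.

Lemma twist_map_tens V W (phi : {linear V -> W}) v w :
  twist_map phi (tens v w) = tens (phi v) w.
Proof. exact: linearZ. Qed.

Record is_connection V (nabla : V -> twist m V) : Prop := IsConnection {
  connectionD : forall u v, nabla (u + v) = nabla u + nabla v;
  connectionZ : forall (c : K) v,
    nabla (tps_const N c *: v) = tps_const N c *: nabla v;
  connection_leibniz : forall (f : A) v,
    nabla (f *: v) = tens v (tps_d m f) + f *: nabla v
}.

(* nabla (S) is contained in S (x) dz/z^m. *)
Definition stable_under V (nabla : V -> twist m V) (S : submodClosed V) : Prop :=
  forall v, v \in S -> (nabla v : V) \in S.

End Connections.

Section Bases.
Variables (A : nzRingType) (V : lmodType A).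

Definition is_basis n (e : 'I_n -> V) : Prop :=
  forall v, exists! c : 'rV[A]_n, v = \sum_(i < n) c 0 i *: e i.

Definition free_of_rank (n : nat) : Prop := exists e : 'I_n -> V, is_basis e.

End Bases.

Definition lmod_iso (A : nzRingType) (V W : lmodType A) : Prop :=
  exists phi : {linear V -> W}, bijective phi.

(* The quotient S / T of submodules of V (in general S / (S :&: T), hence S / T
   when T is contained in S). *)
Section SubQuotient.
Variables (A : nzRingType) (V : lmodType A).

Section SubModule.
Variable S : submodClosed V.

Record submod : Type := SubMod { submod_val :> V; _ : submod_val \in S }.
HB.instance Definition _ := [isSub for submod_val].
HB.instance Definition _ := [Choice of submod by <:].
HB.instance Definition _ := [SubChoice_isSubLmodule of submod by <:].

End SubModule.

Variables S T : submodClosed V.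

Definition relative : {pred submod S} := fun v => val v \in T.

Lemma relativeE v : (v \in relative) = (val v \in T).
Proof. by []. Qed.

Fact relative_submod_closed : submod_closed relative.
Proof.
split=> [|a u v]; rewrite !relativeE ?raddf0 ?rpred0 // => uT vT.
by rewrite linearP /= rpredD // rpredZ.
Qed.
HB.instance Definition _ :=
  GRing.isSubmodClosed.Build A (submod S) relative relative_submod_closed.

Definition subquot : Type := Quotient.quot relative.
HB.instance Definition _ := GRing.Zmodule.on subquot.

Definition subquot_pi (v : submod S) : subquot := \pi_(Quotient.quot relative) v.
Definition subquot_repr (x : subquot) : submod S := repr (x : Quotient.quot relative).

Lemma subquot_reprK : cancel subquot_repr subquot_pi.
Proof. exact: reprK. Qed.

Lemma subquot_piE u v :
  subquot_pi u = subquot_pi v <-> (val u - val v) \in T.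
Proof.
by rewrite -raddfB -relativeE Quotient.idealrBE; split=> /eqP.
Qed.

Lemma subquot_piD u v : subquot_pi (u + v) = subquot_pi u + subquot_pi v.
Proof. exact: (raddfD (\pi_(Quotient.quot relative))). Qed.

Definition subquot_scale (a : A) (x : subquot) : subquot :=
  subquot_pi (a *: subquot_repr x).

Lemma subquot_piZ a v : subquot_pi (a *: v) = subquot_scale a (subquot_pi v).
Proof.
apply/subquot_piE; set u := subquot_repr _.
have -> : val (a *: v) - val (a *: u) = a *: (val v - val u) by rewrite scalerBr.
by rewrite rpredZ //; apply/subquot_piE; rewrite subquot_reprK.
Qed.

Fact subquot_scaleA a b x :
  subquot_scale a (subquot_scale b x) = subquot_scale (a * b) x.
Proof. by rewrite -[x]subquot_reprK -!subquot_piZ scalerA. Qed.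

Fact subquot_scale1 : left_id 1 subquot_scale.
Proof. by move=> x; rewrite -[x]subquot_reprK -subquot_piZ scale1r. Qed.

Fact subquot_scaleDr : right_distributive subquot_scale +%R.
Proof.
move=> a x y; rewrite -[x]subquot_reprK -[y]subquot_reprK -subquot_piD.
by rewrite -!subquot_piZ scalerDr subquot_piD.
Qed.

Fact subquot_scaleDl x : {morph subquot_scale^~ x : a b / a + b}.
Proof.
by move=> a b; rewrite -[x]subquot_reprK -!subquot_piZ scalerDl subquot_piD.
Qed.

HB.instance Definition _ := GRing.Zmodule_isLmodule.Build A subquot
  subquot_scaleA subquot_scale1 subquot_scaleDr subquot_scaleDl.

End SubQuotient.

(* The connection induced on S / T; it is only meaningful when S and T are
   stable under nabla, in which case induced_connectionE holds. *)
Definition induced_connection (K : comNzRingType) (N m : nat)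
    (V : lmodType (tps K N)) (nabla : V -> twist m V) (S T : submodClosed V)
    (x : subquot S T) : twist m (subquot S T) :=
  subquot_pi T (insubd (0 : submod S) (nabla (val (subquot_repr x)) : V)).

Lemma induced_connectionE (K : comNzRingType) (N m : nat)
    (V : lmodType (tps K N)) (nabla : V -> twist m V) (S T : submodClosed V) :
  is_connection nabla -> stable_under nabla S -> stable_under nabla T ->
  forall v w : submod S, val w = nabla (val v) ->
  induced_connection nabla (subquot_pi T v) = subquot_pi T w.
Proof.
move=> cn stS stT v w wE; apply/subquot_piE.
set u := subquot_repr _; have uv : val u - val v \in T.
  by apply/subquot_piE; rewrite subquot_reprK.
rewrite insubdK; last exact: stS (valP u).
have eT : (nabla (val u - val v) : V) = nabla (val u) - nabla (val v).
  by apply/eqP; rewrite eq_sym subr_eq -(connectionD cn) subrK.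
by rewrite wE -eT; apply: stT.
Qed.

(* Main.v *)
(* In bases adapted to the filtrations, [phi] is an invertible matrix [P] with
   [delta P + B P = P A], where [delta = z^m d/dz] and [A], [B] are lower
   triangular with the polar parts on the diagonal. The last column [g] of [P]
   spans the image of the last step of the filtration of [V]. Reading
   [delta g + B g = p g] from the top, as long as the entries are divisible by a
   high power of [z], the next entry is so too, up to a loss of [m - 1] in the
   exponent, unless it is a unit and the polar parts [p] and [q_j] coincide; this
   is where the bounds on the real parts enter. Since [P] is invertible the second
   alternative occurs for some first index [j]. In the quotient of [W] by the image
   line, the images of the other basis vectors are again triangular modulo a high
   power of [z], with the diagonal entry of index [j] removed, and one concludes by
   induction on the rank. The total loss is at most [r^2 (m - 1)], which is less
   than [r^2 m]. *)

Require Import Defs.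
From mathcomp Require Import all_boot all_order all_fingroup all_algebra.
From mathcomp Require Import complex reals.
From mathcomp Require Import qpoly boolp.
From mathcomp Require Import ring lra zify.

Set Implicit Arguments.
Unset Strict Implicit.
Unset Printing Implicit Defensive.

Import GRing.Theory Num.Theory.
Local Open Scope ring_scope.

(** * Matrix products with one row or column singled out *)

Section SplitIndex.
Variable R : comNzRingType.

Lemma mulmx_split n p l (j : 'I_n.+1) (M : 'M[R]_(p, n.+1)) (M' : 'M_(n.+1, l)) :
  M *m M' = col' j M *m row' j M' + col j M *m row j M'.
Proof.
apply/matrixP=> i k; rewrite !mxE (bigD1_ord j) //= addrC; congr (_ + _).
  by apply: eq_bigr => s _; rewrite !mxE.
by rewrite big_ord1 !mxE.
Qed.

Lemma row'_mul n p l (j : 'I_n.+1) (M : 'M[R]_(n.+1, p)) (M' : 'M_(p, l)) :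
  row' j (M *m M') = row' j M *m M'.
Proof. by rewrite !row'Esub mul_rowsub_mx. Qed.

Lemma col'_mul n p l (j : 'I_n.+1) (M : 'M[R]_(l, p)) (M' : 'M_(p, n.+1)) :
  col' j (M *m M') = M *m col' j M'.
Proof. by rewrite !col'Esub mulmx_colsub. Qed.

Lemma col_mul n p l (j : 'I_n) (M : 'M[R]_(l, p)) (M' : 'M_(p, n)) :
  col j (M *m M') = M *m col j M'.
Proof. by rewrite !colE mulmxA. Qed.

End SplitIndex.

(** * Triangular differential systems modulo a chain of ideals *)

Section TriangularSystems.
Variables (R : comNzRingType) (delta : R -> R).
Hypothesis deltaD : {morph delta : x y / x + y}.
Hypothesis deltaM : forall x y, delta (x * y) = delta x * y + x * delta y.
(* [J] is an increasing chain of ideals; [J e] stands for [z^(N - e)]. *)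
Variables (J : nat -> R -> Prop) (d : nat).
Hypothesis J0 : forall e, J e 0.
Hypothesis JD : forall e x y, J e x -> J e y -> J e (x + y).
Hypothesis JM : forall e x y, J e y -> J e (x * y).
Hypothesis J_mono : forall e e' x, (e <= e')%N -> J e x -> J e' x.

Let delta0 : delta 0 = 0.
Proof. by apply: (addrI (delta 0)); rewrite -deltaD !addr0. Qed.

Let deltaN x : delta (- x) = - delta x.
Proof. by apply: (addrI (delta x)); rewrite -deltaD !subrr. Qed.

Let JN e x : J e x -> J e (- x).
Proof. by rewrite -mulN1r; apply: JM. Qed.

Lemma delta_mxD n p (M M' : 'M[R]_(n, p)) :
  map_mx delta (M + M') = map_mx delta M + map_mx delta M'.
Proof. by apply/matrixP=> i k; rewrite !mxE deltaD. Qed.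

Lemma delta_mxN n p (M : 'M[R]_(n, p)) : map_mx delta (- M) = - map_mx delta M.
Proof. by apply/matrixP=> i k; rewrite !mxE deltaN. Qed.

Lemma delta_mxM n p l (M : 'M[R]_(n, p)) (M' : 'M_(p, l)) :
  map_mx delta (M *m M') = map_mx delta M *m M' + M *m map_mx delta M'.
Proof.
apply/matrixP=> i k; rewrite !mxE (big_morph delta deltaD delta0) -big_split /=.
by apply: eq_bigr => s _; rewrite deltaM !mxE.
Qed.

Section Project.
Variables (n : nat) (j : 'I_n.+1) (t : 'cV[R]_n.+1).
Hypothesis tj : t j 0 = 1.

(* Coordinates, in the basis of the [f_k] with [k != j], of the quotient by the line
   spanned by the vector [t], whose [j]-th coordinate is [1]. *)
Definition project l (M : 'M[R]_(n.+1, l)) : 'M_(n, l) :=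
  row' j (M - t *m row j M).

Lemma projectE l (M : 'M[R]_(n.+1, l)) k i :
  project M k i = M (lift j k) i - t (lift j k) 0 * M j i.
Proof. by rewrite !mxE big_ord1 !mxE. Qed.

Lemma project_mul l p (M : 'M[R]_(n.+1, l)) (M' : 'M_(l, p)) :
  project (M *m M') = project M *m M'.
Proof. by rewrite /project -row'_mul mulmxBl row_mul mulmxA. Qed.

Lemma project_add l (M M' : 'M[R]_(n.+1, l)) :
  project (M + M') = project M + project M'.
Proof. by apply/matrixP=> k i; rewrite !(projectE, mxE); ring. Qed.

Lemma project_col l (M : 'M[R]_(n.+1, l)) i : col i (project M) = project (col i M).
Proof. by apply/matrixP=> k s; rewrite !(projectE, mxE). Qed.

(** Since [t j 0 = 1], row [j] of [M - t *m row j M] is zero, so deleting it together with column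
    [j] of [B] loses nothing. *)
Lemma mul_project p l (B : 'M[R]_(p, n.+1)) (M : 'M[R]_(n.+1, l)) :
  col' j B *m project M = B *m M - B *m t *m row j M.
Proof.
have rj0 : row j (M - t *m row j M) = 0.
  by apply/matrixP=> k i; rewrite !mxE big_ord1 !mxE tj mul1r subrr.
by rewrite -mulmxA -mulmxBr [RHS](mulmx_split j) rj0 mulmx0 addr0.
Qed.

(* The connection matrix on the quotient is [col' j (project B)]; the error term
   vanishes when the line is stable under the connection. *)
Lemma delta_project l (B : 'M[R]_n.+1) (M : 'M[R]_(n.+1, l)) :
  map_mx delta (project M) + col' j (project B) *m project M =
  project (map_mx delta M + B *m M) -
    (row' j (map_mx delta t) + project (B *m t)) *m row j M.
Proof.
rewrite mul_project project_add !project_mul mulmxDl.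
have -> : map_mx delta (project M) =
    project (map_mx delta M) - row' j (map_mx delta t) *m row j M.
  apply/matrixP=> k i; rewrite !(projectE, mxE) big_ord1 !mxE.
  by rewrite deltaD deltaN deltaM; ring.
by rewrite addrACA opprD.
Qed.

End Project.

(* The entries of a horizontal map between the rank one connections [p] and [q]
   satisfy [delta g + (q - p) g = 0] up to terms of [J e]. *)
Definition dichotomy (p q : R) := forall e g, J e (delta g + (q - p) * g) ->
  J (e + d) g \/ p = q /\ exists u, g * u = 1.

(** Induction on [s]. In row [s], the terms left of the diagonal are small by induction and those to
    its right because of [B], so a scalar equation remains, to which [dichotomy] applies. In the
    unit case the exponent is relaxed to [e + n * d], which does not depend on [j]. *)
Lemma first_unit n e (B : 'M[R]_n) (p : R) (q : 'I_n -> R) (g : 'cV[R]_n) :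
  (forall i k : 'I_n, (i < k)%N -> J e (B i k)) -> (forall i, J e (B i i - q i)) ->
  (forall i, dichotomy p (q i)) ->
  map_mx delta g + B *m g = p *: g ->
  forall s, (s <= n)%N ->
  (exists j : 'I_n, [/\ p = q j, exists u, g j 0 * u = 1 &
     forall i : 'I_n, (i < j)%N -> J (e + n * d) (g i 0)]) \/
  (forall i : 'I_n, (i < s)%N -> J (e + s * d) (g i 0)).
Proof.
move=> Bt Bd pq eqg; elim=> [|s IH] lt_sn; first by right.
have [|small] := IH (ltnW lt_sn); first by left.
pose k := Ordinal lt_sn.
have le_e : (e <= e + s * d)%N by rewrite leq_addr.
have eqk : J (e + s * d) (delta (g k 0) + (q k - p) * g k 0).
  have := congr1 (fun M : 'cV_n => M k 0) eqg; rewrite !mxE (bigD1 k) //= => eqgk.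
  have -> : delta (g k 0) + (q k - p) * g k 0 = - (g k 0 * (B k k - q k)) +
     - (\sum_(i < n | i != k) B k i * g i 0).
    move/eqP: eqgk; rewrite addrA -subr_eq0 -addrA addrC => /eqP eqgk.
    apply/eqP; rewrite -subr_eq0 -[X in _ == X]eqgk; apply/eqP; ring.
  apply: JD; apply: JN; first by apply: JM; apply: J_mono (Bd k).
  elim/big_ind: _ => [|x y|i /negbTE ik]; [exact: J0|exact: JD|].
  have [lt_ik|lt_ki|/val_inj eik] := ltngtP i k.
  - by apply: JM; apply: small.
  - by rewrite mulrC; apply: JM; apply: J_mono (Bt _ _ lt_ki).
  - by rewrite eik eqxx in ik.
have sS : (e + s * d + d = e + s.+1 * d)%N by rewrite mulSn; lia.
have [Jg|[pqk unitg]] := pq k _ _ eqk.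
  right=> i; rewrite ltnS leq_eqVlt => /orP[/eqP ei|lt_is].
    by have -> : i = k; [apply: val_inj | rewrite -sS].
  by apply: J_mono (small i lt_is); rewrite mulSn; lia.
left; exists k; split=> // i lt_ik; apply: J_mono (small i lt_ik).
by rewrite leq_add2l leq_mul2r ltnW ?orbT.
Qed.

(** [A] stays exactly triangular, as only its last row and column are deleted; [B] becomes the
    matrix of a quotient and is triangular only modulo [J e]. A step in rank [n] raises [e] by
    [n * d], so [n * n * d] bounds the total loss. *)
Lemma triangular_matching n e (A B P Q : 'M[R]_n) (p q : 'I_n -> R) :
  ~ J (e + n * n * d) 1 ->
  (forall i k : 'I_n, (i < k)%N -> A i k = 0) -> (forall i, A i i = p i) ->
  (forall i k : 'I_n, (i < k)%N -> J e (B i k)) -> (forall i, J e (B i i - q i)) ->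
  (forall i k, dichotomy (p i) (q k)) ->
  Q *m P = 1%:M ->
  map_mx delta P + B *m P = P *m A ->
  exists sigma : 'S_n, forall i, p i = q (sigma i).
Proof.
elim: n e A B P Q p q => [|n IH] e A B P Q p q J1 At Ad Bt Bd pq QP eqBPA.
  by exists 1%g; case.
pose last : 'I_n.+1 := ord_max; pose g := col last P.
(* The last column of the lower triangular [A] is zero off the diagonal. *)
have eqg : map_mx delta g + B *m g = p last *: g.
  have := congr1 (col last) eqBPA; rewrite linearD /= -map_col !col_mul => ->.
  apply/matrixP=> i k; rewrite !mxE (bigD1 last) //= big1 ?addr0 => [|s s_l].
    by rewrite !mxE Ad mulrC.
  rewrite !mxE At ?mulr0 // ltn_neqAle -ltnS ltn_ord andbT.
  by rewrite -val_eqE in s_l.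
have [[j [pqj [u gju] small]]|/(_ _ (ltn_ord _)) small] :=
  first_unit Bt Bd (pq last) eqg (leqnn _); last first.
  (* If all entries of [g] were small, so would be the last entry of [Q *m g], which is [1]. *)
  case: J1; have <- : (Q *m g) last 0 = 1.
    by rewrite -col_mul QP !mxE eqxx.
  rewrite mxE; elim/big_ind: _ => [|x y|i _]; [exact: J0|exact: JD|].
  by apply: JM; apply: J_mono (small i); nia.
pose t := u *: g.
have tj : t j 0 = 1 by rewrite mxE mulrC.
have tg : t *m row j g = g.
  have gju' := gju; rewrite mxE in gju'.
  by apply/matrixP=> i k; rewrite !mxE big_ord1 !mxE mulrAC (mulrC u) gju' mul1r.
have pg : project j t g = 0 by rewrite /project tg subrr linear0.
(* The line is stable: [delta_project] applied to [g] leaves only this term times [g j 0], which is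
   a unit. *)
have corr : row' j (map_mx delta t) + project j t (B *m t) = 0.
  have := delta_project tj B g; rewrite pg mulmx0 addr0 eqg.
  have -> : project j t (p last *: g) = 0.
    by rewrite -mul_mx_scalar project_mul pg mul0mx.
  rewrite [map_mx _ _](_ : _ = 0); last by apply/matrixP=> k i; rewrite !mxE delta0.
  set X := row' _ _ + _; rewrite sub0r => /esym/eqP; rewrite oppr_eq0 => /eqP Xg.
  clearbody X; apply/matrixP=> k i; rewrite ord1 [RHS]mxE -[LHS]mulr1 -gju mulrA.
  have := congr1 (fun M : 'M_(_, 1) => M k 0) Xg.
  by rewrite !mxE big_ord1 !mxE => ->; rewrite mul0r.
have J_le (x : R) : J e x -> J (e + n.+1 * d) x by apply: J_mono; rewrite leq_addr.
have B'E i k : col' j (project j t B) i k =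
    B (lift j i) (lift j k) - t (lift j i) 0 * B j (lift j k).
  by rewrite mxE projectE.
have [||||||||s ps] := IH (e + n.+1 * d)%N (row' last (col' last A))
  (col' j (project j t B)) (col' last (project j t P)) (row' last (col' j Q))
  (p \o lift last) (q \o lift j).
- by move=> J1'; apply: J1; apply: J_mono J1'; nia.
- by move=> i k lt_ik; rewrite !mxE At // ltnNge leq_bump2 -ltnNge.
- by move=> i; rewrite !mxE Ad.
(* In the correction [t (lift j i) 0 * B j (lift j k)], the first factor is small if [lift j i < j];
   otherwise [j < lift j k] and the second factor lies above the diagonal of [B]. *)
- move=> i k lt_ik; rewrite B'E.
  apply: JD; first by apply/J_le/Bt; rewrite ltnNge leq_bump2 -ltnNge.
  apply: JN; have [lt_j|le_j] := ltnP (lift j i) j.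
    by rewrite mulrC !mxE; do 2!apply: JM; have := small _ lt_j; rewrite mxE.
  apply/JM/J_le/Bt; apply: leq_ltn_trans le_j _.
  by rewrite ltnNge leq_bump2 -ltnNge.
- move=> i; rewrite B'E addrAC.
  apply: JD; first exact/J_le/Bd.
  apply: JN; have [lt_j|le_j] := ltnP (lift j i) j.
    by rewrite mulrC !mxE; do 2!apply: JM; have := small _ lt_j; rewrite mxE.
  apply/JM/J_le/Bt; rewrite ltn_neqAle le_j andbT.
  exact: neq_lift.
- by move=> i k; apply: pq.
(* [Q *m t] is [u] times the last basis vector, so the correction disappears with the last row. *)
- have Qt : row' last (Q *m t) = 0.
    rewrite /t -scalemxAr -col_mul QP; apply/matrixP=> k i.
    by rewrite !mxE eq_sym (negbTE (neq_lift _ _)) mulr0.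
  rewrite -row'_mul -col'_mul mul_project // QP.
  have : row' last (Q *m t *m row j P) = 0 by rewrite row'_mul Qt mul0mx.
  move: (Q *m t *m row j P) => M M0; apply/matrixP=> k i.
  have := congr1 (fun N : 'M_(n, n.+1) => N k (lift last i)) M0.
  by rewrite !mxE => ->; rewrite subr0 (inj_eq lift_inj).
(* The last column of [project j t P] is [project j t g = 0], so the last row of [A] contributes
   nothing. *)
- have := delta_project tj B P; rewrite eqBPA corr mul0mx subr0 project_mul.
  move/(congr1 (col' last)); rewrite linearD /= -map_col' !col'_mul => ->.
  rewrite [LHS](mulmx_split last) project_col -/g pg mul0mx addr0.
  by rewrite col'Esub.
exists (lift_perm last j s) => i.
case: (unliftP last i) => [k|] ->; first by rewrite lift_perm_lift; apply: ps.
by rewrite lift_perm_id.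
Qed.

End TriangularSystems.

(** * The scalar dichotomy for truncated power series *)

Section TruncatedDichotomy.
Variables (K : numFieldType) (N m : nat).
Hypotheses (N_gt0 : (0 < N)%N) (m_gt0 : (0 < m)%N).
Local Notation A := (tps K N).
Local Notation delta := (fun x : A => tps_d m x : A).

Lemma in_qpoly_val (x : A) : in_qpoly 'X^N (x : {poly K}) = x.
Proof.
apply: val_inj; apply/polyP => i; rewrite in_qpolyXN //; case: ltnP => // le_Ni.
rewrite nth_default //; apply: leq_trans (size_npoly x) _.
by rewrite mk_monic_XN // size_polyXn.
Qed.

Lemma tps_mulE (x y : A) : x * y = in_qpoly 'X^N ((x : {poly K}) * (y : {poly K})).
Proof. by []. Qed.

Lemma tps_coefD (x y : A) i :
  (x + y : {poly K})`_i = (x : {poly K})`_i + (y : {poly K})`_i.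
Proof. by rewrite poly_of_qpolyD coefD. Qed.

Lemma tps_coefM (x y : A) i : (i < N)%N ->
  (x * y : {poly K})`_i =
  \sum_(k < i.+1) (x : {poly K})`_k * (y : {poly K})`_(i - k).
Proof. by move=> lt_iN; rewrite tps_mulE in_qpolyXN // lt_iN coefM. Qed.

Lemma tps_coef_d (x : A) i : (i < N)%N ->
  ((tps_d m x : A) : {poly K})`_i =
  if (i < m)%N then 0 else (x : {poly K})`_(i - m).+1 *+ (i - m).+1.
Proof.
by move=> lt_iN; rewrite in_qpolyXN // lt_iN coefXnM coef_deriv.
Qed.

Lemma tps_dD : {morph delta : x y / x + y}.
Proof.
by move=> x y; rewrite /tps_d poly_of_qpolyD derivD mulrDr in_qpolyD.
Qed.

Lemma tps_dM (x y : A) : delta (x * y) = delta x * y + x * delta y.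
Proof.
rewrite [in LHS]tps_mulE tps_dE // derivM mulrDr mulrA mulrCA in_qpolyD.
by congr (_ + _); rewrite in_qpolyM in_qpoly_val.
Qed.

(** The ideal generated by [z^(N - e)]; the subtraction is truncated, so it is the whole ring once
    [N <= e]. *)
Definition vanishes (e : nat) (x : A) : Prop :=
  forall i, (i < N - e)%N -> (x : {poly K})`_i = 0.

Lemma vanishes0 e : vanishes e 0.
Proof. by move=> i _; rewrite coef0. Qed.

Lemma vanishesD e x y : vanishes e x -> vanishes e y -> vanishes e (x + y).
Proof. by move=> x0 y0 i lt_i; rewrite tps_coefD x0 ?y0 ?addr0. Qed.

Lemma vanishesM e x y : vanishes e y -> vanishes e (x * y).
Proof.
move=> y0 i lt_i; rewrite tps_coefM; last by apply: leq_trans lt_i (leq_subr _ _).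
apply: big1 => k _; rewrite y0 ?mulr0 //.
by apply: leq_ltn_trans lt_i; rewrite leq_subr.
Qed.

Lemma vanishes_mono e e' x : (e <= e')%N -> vanishes e x -> vanishes e' x.
Proof. by move=> le_e x0 i lt_i; apply: x0; apply: leq_trans lt_i (leq_sub2l _ _). Qed.

(** A nonzero constant term makes the representing polynomial coprime to ['X^N]. *)
Lemma tps_unit (x : A) : (x : {poly K})`_0 != 0 -> exists y, x * y = 1.
Proof.
move=> x0; exists (qpoly_inv x); rewrite mulrC qpoly_mulVz //.
move: (x : {poly K}) x0 => p p0; rewrite mk_monic_XN // coprimep_expl //.
have := coprimep_XsubC p 0; rewrite coprimep_sym polyC0 subr0 => ->.
by rewrite rootE horner_coef0.
Qed.

Definition polar (a : nat -> K) : A :=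
  \sum_(1 <= k < m.+1) tps_const N (a k) * tps_z K N ^+ (m - k).

Lemma polar_coef a i : (i < N)%N ->
  (polar a : {poly K})`_i = if (i < m)%N then a (m - i)%N else 0.
Proof.
move=> lt_iN.
have cE (c : K) : tps_const N c = in_qpoly 'X^N c%:P.
  apply: val_inj; apply/polyP => k; rewrite in_qpolyXN // /tps_const /= coefC.
  by case: ltnP => //; case: k => // /(leq_trans N_gt0).
have -> : polar a = in_qpoly 'X^N (\sum_(1 <= k < m.+1) (a k)%:P * 'X^(m - k)).
  rewrite raddf_sum; apply: eq_bigr => k _.
  rewrite cE [RHS]in_qpolyM; congr (_ * _).
  elim: (m - k)%N => [|n IHn]; first by rewrite !expr0 in_qpoly1.
  by rewrite !exprS IHn -in_qpolyM.
rewrite in_qpolyXN // lt_iN coef_sum.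
under eq_bigr => k _ do rewrite coefCM coefXn.
case: ltnP => [lt_im|le_mi]; last first.
  rewrite big_nat big1 // => k /andP[k_gt0 _].
  by rewrite (_ : (i == _) = false) ?mulr0 //; lia.
have mem_mi : (m - i)%N \in index_iota 1 m.+1 by rewrite mem_index_iota; lia.
rewrite (bigD1_seq _ mem_mi (iota_uniq _ _)) /=.
rewrite subKn ?(ltnW lt_im) // eqxx mulr1 big_nat_cond big1 ?addr0 // => k.
by move=> /andP[k_m k_i]; rewrite (_ : (i == _) = false) ?mulr0 //; lia.
Qed.

(** Compare coefficients, with [c = polar b - polar a]. If [c = 0], the derivation, which raises
    degrees by [m - 1], forces all low coefficients of [g] but the constant one to vanish, and that
    one is zero or makes [g] a unit. If [c] has order [s], then [s < m] and the coefficient of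
    degree [k + s] determines [g_k] from earlier ones. *)
Lemma polar_dichotomy (a b : nat -> K) :
  (forall k, (0 < k)%N -> b 1%N - a 1%N + k%:R != 0) ->
  dichotomy delta vanishes m.-1 (polar a) (polar b).
Proof.
move=> res e g eqg.
pose c : A := polar b - polar a.
have cE i : (i < N)%N ->
    (c : {poly K})`_i = if (i < m)%N then b (m - i)%N - a (m - i)%N else 0.
  move=> lt_iN; rewrite /c raddfB /= coefB !polar_coef //.
  by case: ifP; rewrite ?subr0.
have eqgi i : (i < N - e)%N ->
    (if (i < m)%N then 0 else (g : {poly K})`_(i - m).+1 *+ (i - m).+1) +
    \sum_(k < i.+1) (c : {poly K})`_k * (g : {poly K})`_(i - k) = 0.
  move=> lt_i; have lt_iN : (i < N)%N by apply: leq_trans lt_i (leq_subr _ _).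
  have := eqg i lt_i; rewrite tps_coefD tps_coefM //.
  by rewrite -[X in X + _]/(((tps_d m g : A) : {poly K})`_i) tps_coef_d.
have [cs|c0] := pselect (exists s, (c : {poly K})`_s != 0); last first.
  have {}c0 i : (c : {poly K})`_i = 0.
    by apply/eqP/negPn/negP => ci; apply: c0; exists i.
  have g0 i : (i.+1 < N - (e + m.-1))%N -> (g : {poly K})`_i.+1 = 0.
    move=> lt_i; have lt_im : (i + m < N - e)%N by lia.
    have := eqgi _ lt_im; rewrite ltnNge leq_addl /= addnK big1 => [|k _].
      by rewrite addr0 => /eqP; rewrite mulrn_eq0 => /eqP.
    by rewrite c0 mul0r.
  have [g00|/tps_unit ug] := eqVneq ((g : {poly K})`_0) 0.
    by left=> -[|i] lt_i; [exact: g00|exact: g0].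
  right; split=> //; apply/eqP; rewrite eq_sym -subr_eq0; apply/eqP.
  by apply: val_inj; apply/polyP => i; rewrite [LHS]c0 coef0.
left; have [s c_s s_min] := ex_minnP cs.
have c_lt k : (k < s)%N -> (c : {poly K})`_k = 0.
  by move=> lt_ks; apply/eqP/negPn/negP => /s_min; rewrite leqNgt lt_ks.
have lt_sN : (s < N)%N.
  rewrite ltnNge; apply: contra c_s => le_Ns.
  by rewrite -(in_qpoly_val c) in_qpolyXN // ltnNge le_Ns.
have lt_sm : (s < m)%N by move: c_s; rewrite cE //; case: ltnP; rewrite ?eqxx.
elim/ltn_ind => k IH lt_k.
have lt_ks : (k + s < N - e)%N by lia.
(* Only [c_s * g_k] survives in the product: the terms before it vanish by minimality of [s], those
   after it by induction. *)
have := eqgi _ lt_ks; rewrite (bigD1 (inord s)) //= inordK; last by lia.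
rewrite addnK [X in _ + (_ + X)]big1 ?addr0 => [|i i_s]; last first.
  have [lt_is|le_si] := ltnP i s; first by rewrite c_lt ?mul0r.
  have {i_s} ne_is : (i != s :> nat).
    by apply: contra i_s => /eqP ei; apply/eqP/val_inj; rewrite /= inordK ?ei //; lia.
  by have := ltn_ord i => lt_i; rewrite IH ?mulr0 //; lia.
have [lt_ksm|le_mks] := ltnP (k + s) m.
  by rewrite add0r => /eqP; rewrite mulf_eq0 (negbTE c_s) => /eqP.
have [es|ne_s] := eqVneq s m.-1; last first.
  (* For [s < m - 1] the derivative term involves a coefficient of [g] of index below [k]. *)
  rewrite IH ?mul0rn ?add0r; [|lia|lia].
  by move=> /eqP; rewrite mulf_eq0 (negbTE c_s) => /eqP.
(* For [s = m - 1] the equation is [(b_1 - a_1 + k) * g_k = 0], where [k > 0] because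
   [m <= k + s]. *)
have -> : ((k + s - m).+1 = k)%N by lia.
rewrite cE // lt_sm es (_ : m - m.-1 = 1)%N; last by lia.
rewrite -mulr_natl -mulrDl addrC => /eqP; rewrite mulf_eq0.
by rewrite (negbTE (res k _)) => [/eqP|]; last by lia.
Qed.

End TruncatedDichotomy.

(** * Frames adapted to a filtration *)

Lemma submod_rpredN (A : nzRingType) (V : lmodType A) (S : submodClosed V) (x : V) :
  x \in S -> - x \in S.
Proof. by rewrite -scaleN1r => /rpredZ. Qed.

Section FilteredFrame.
Variables (K : comNzRingType) (N m r : nat).
Local Notation A := (tps K N).
Variables (V : lmodType A) (nabla : V -> twist m V).
Hypothesis cn : is_connection nabla.
Variable F : nat -> submodClosed V.
Hypotheses (F0 : forall v, v \in F 0%N) (Fr : forall v, (v \in F r) = (v == 0)).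
Hypothesis FS : forall i, (i < r)%N -> {subset F i.+1 <= F i}.
Hypothesis st : forall i, (i <= r)%N -> stable_under nabla (F i).
Variables (e : forall i : 'I_r, subquot (F i) (F i.+1)) (p : 'I_r -> A).
Hypothesis be : forall i, is_basis (fun _ : 'I_1 => e i).
Hypothesis he : forall i, induced_connection nabla (e i) = tens (e i) (p i : Defs.form K N m).

Lemma filtration_mono i k : (i <= k <= r)%N -> {subset F k <= F i}.
Proof.
move=> /andP[/subnKC <-]; elim: (k - i)%N => [|n IH]; first by rewrite addn0 => _ x.
by rewrite addnS => lt_r x /(FS lt_r); apply: IH; apply: ltnW.
Qed.

Definition lift_basis (i : 'I_r) : V := val (subquot_repr (e i)).

Lemma lift_basis_mem (i : 'I_r) k : (k <= i)%N -> lift_basis i \in F k.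
Proof.
move=> le_ki; apply: (@filtration_mono k i); first by rewrite le_ki ltnW.
exact: valP.
Qed.

Lemma subquot_pi_scale (i : 'I_r) a :
  subquot_pi (F i.+1) (a *: subquot_repr (e i)) = a *: e i.
Proof. by rewrite subquot_piZ subquot_reprK. Qed.

Lemma leading_coef (i : 'I_r) x : x \in F i ->
  exists a, x - a *: lift_basis i \in F i.+1.
Proof.
move=> xF; have [c [cE _]] := @be i (subquot_pi (F i.+1) (SubMod xF)).
exists (c 0 0); move: cE; rewrite big_ord1 -subquot_pi_scale.
by move=> /subquot_piE.
Qed.

Lemma leading_coef0 (i : 'I_r) a : a *: lift_basis i \in F i.+1 -> a = 0.
Proof.
move=> aF; have [c [_ uc]] := @be i 0.
have c0 : c = 0 by apply: uc; rewrite big_ord1 mxE scale0r.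
have: c = const_mx a.
  apply: uc; rewrite big_ord1 mxE -subquot_pi_scale.
  have -> : 0 = subquot_pi (F i.+1) 0 :> subquot (F i) (F i.+1).
    by rewrite -(scale0r (subquot_repr (e i))) subquot_pi_scale scale0r.
  have : 0 - a *: lift_basis i \in F i.+1 by rewrite sub0r submod_rpredN.
  by move=> aF0; apply/subquot_piE; exact: aF0.
by rewrite c0 => /matrixP/(_ 0 0); rewrite !mxE.
Qed.

(** Descending induction on [k]: subtracting the leading term moves [x] into the next step of the
    filtration. *)
Lemma frame_span k x : (k <= r)%N -> x \in F k ->
  exists c : 'I_r -> A, (forall i : 'I_r, (i < k)%N -> c i = 0) /\
    x = \sum_i c i *: lift_basis i.
Proof.
move=> le_kr; have [n kn] : exists n, (n + k = r)%N by exists (r - k)%N; rewrite subnK.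
elim: n k x {le_kr} kn => [|n IH] k x kn.
  rewrite add0n in kn; rewrite kn Fr => /eqP ->; exists (fun=> 0); split=> //.
  by rewrite big1 // => i _; rewrite scale0r.
have lt_kr : (k < r)%N by rewrite -kn addSn ltnS leq_addl.
move=> /(@leading_coef (Ordinal lt_kr))[a /IH[|c [c0 xE]]].
  by rewrite /= -kn addnS addSn.
exists (fun i => c i + (if i == Ordinal lt_kr then a else 0)); split=> [i lt_ik|].
  rewrite c0 ?add0r; last by apply: leq_trans lt_ik _; rewrite /= leqnSn.
  by rewrite -val_eqE /= ltn_eqF.
under eq_bigr => i _ do rewrite scalerDl.
rewrite big_split -xE /= (bigD1 (Ordinal lt_kr)) //= eqxx big1 ?addr0 ?subrK //.
by move=> i /negbTE ->; rewrite scale0r.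
Qed.

(** Once the earlier coefficients vanish, [c i *: lift_basis i] is minus a combination of later
    vectors, hence is zero in the graded piece. *)
Lemma frame_free (c : 'I_r -> A) :
  \sum_i c i *: lift_basis i = 0 -> forall i, c i = 0.
Proof.
move=> c0 [i lt_ir]; elim/ltn_ind: i lt_ir => i IH lt_ir.
apply: (@leading_coef0 (Ordinal lt_ir)); move: c0; rewrite (bigD1 (Ordinal lt_ir)) //=.
move=> /eqP; rewrite addr_eq0 => /eqP ->.
apply: submod_rpredN; rewrite rpred_sum // => -[k lt_kr] k_i.
have [lt_ki|lt_ik|eki] := ltngtP k i.
- by rewrite IH // scale0r rpred0.
- by rewrite rpredZ // lift_basis_mem.
- by rewrite -val_eqE /= eki eqxx in k_i.
Qed.

Lemma triangular_frame : exists (v : 'I_r -> V) (M : 'M[A]_r),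
  [/\ forall x, exists c : 'I_r -> A, x = \sum_i c i *: v i,
      forall c : 'I_r -> A, \sum_i c i *: v i = 0 -> forall i, c i = 0,
      forall i, (nabla (v i) : V) = \sum_k M k i *: v k,
      forall i k : 'I_r, (i < k)%N -> M i k = 0 &
      forall i, M i i = p i].
Proof.
have colM (i : 'I_r) : exists c : 'I_r -> A,
    [/\ (nabla (lift_basis i) : V) = \sum_k c k *: lift_basis k,
        forall k : 'I_r, (k < i)%N -> c k = 0 & c i = p i].
  have le_ir : (i <= r)%N by rewrite ltnW.
  have nF : (nabla (lift_basis i) : V) \in F i by apply/(st le_ir)/valP.
  have := he i; rewrite -{1}[e i]subquot_reprK.
  rewrite (induced_connectionE cn (st le_ir) (st (ltn_ord i)) (w := SubMod nF)) //.
  rewrite -[tens _ _]/(p i *: e i) -subquot_pi_scale.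
  move=> /subquot_piE /(frame_span (ltn_ord i))[c [c0 cE]].
  (* [c] expands the remainder [nabla (lift_basis i) - p i *: lift_basis i], which lies in [F i.+1];
     the diagonal term is put back. *)
  exists (fun k => c k + (if k == i then p i else 0)); split.
  - under eq_bigr => k _ do rewrite scalerDl.
    rewrite big_split -cE /= (bigD1 i) //= eqxx big1 ?addr0 => [|k /negbTE ->].
      by rewrite subrK.
    by rewrite scale0r.
  - by move=> k lt_ki; rewrite c0 ?add0r ?ltnS ?(ltnW lt_ki) // -val_eqE /= ltn_eqF.
  - by rewrite c0 ?ltnSn // eqxx add0r.
have [M ME] := choice colM.
exists lift_basis, (\matrix_(k, i) M i k); split.
- by move=> x; have [c [_ ->]] := frame_span (leq0n r) (F0 x); exists c.
- exact: frame_free.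
- by move=> i; have [-> _ _] := ME i; apply: eq_bigr => k _; rewrite mxE.
- by move=> i k lt_ik; have [_ c0 _] := ME k; rewrite mxE c0.
- by move=> i; rewrite mxE; have [_ _ ->] := ME i.
Qed.

Lemma connection_sum n (c : 'I_n -> A) (v : 'I_n -> V) :
  (nabla (\sum_i c i *: v i) : V) =
  \sum_i ((tps_d m (c i) : A) *: v i + c i *: (nabla (v i) : V)).
Proof.
have n0 : (nabla 0 : V) = 0.
  by apply: (addrI (nabla 0 : V)); rewrite -[LHS](connectionD cn) !addr0.
rewrite (big_morph (nabla : V -> V) (connectionD cn) n0).
by apply: eq_bigr => i _; apply: (connection_leibniz cn).
Qed.

End FilteredFrame.

(** * Residues, and the comparison of the two filtered modules *)

Lemma residue_shift_neq0 (RR : realType) (x y : RR[i]) n :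
  complex.Re x < 1 -> 0 <= complex.Re y -> (0 < n)%N -> y - x + n%:R != 0.
Proof.
rewrite -(rmorph_nat (real_complex RR)) -(ler1n RR).
case: x y => [x1 x2] [y1 y2] /= x_lt1 y_ge0 n_ge1; apply/eqP => -[re0 _].
by move: re0 x_lt1 y_ge0 n_ge1; lra.
Qed.

Theorem proposition1p2
  (RR : realType) (r m : nat) (hr : (0 < r)%N) (hm : (0 < m)%N)
  (V W : lmodType (tps RR[i] (r ^ 2 * m)))
  (hV : free_of_rank V r) (hW : free_of_rank W r)
  (nablaV : V -> twist m V) (nablaW : W -> twist m W)
  (cV : is_connection nablaV) (cW : is_connection nablaW)
  (FV : nat -> submodClosed V) (FW : nat -> submodClosed W)
  (FV0 : forall v, v \in FV 0%N) (FW0 : forall w, w \in FW 0%N)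
  (FVr : forall v, (v \in FV r) = (v == 0))
  (FWr : forall w, (w \in FW r) = (w == 0))
  (FVS : forall i, (i < r)%N -> {subset FV i.+1 <= FV i})
  (FWS : forall i, (i < r)%N -> {subset FW i.+1 <= FW i})
  (grV : forall i, (i < r)%N ->
    lmod_iso (subquot (FV i) (FV i.+1)) (tps RR[i] (r ^ 2 * m))^o)
  (grW : forall i, (i < r)%N ->
    lmod_iso (subquot (FW i) (FW i.+1)) (tps RR[i] (r ^ 2 * m))^o)
  (stV : forall i, (i <= r)%N -> stable_under nablaV (FV i))
  (stW : forall i, (i <= r)%N -> stable_under nablaW (FW i))
  (eV : forall i : 'I_r, subquot (FV i) (FV i.+1))
  (eW : forall i : 'I_r, subquot (FW i) (FW i.+1))
  (beV : forall i, is_basis (fun _ : 'I_1 => eV i))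
  (beW : forall i, is_basis (fun _ : 'I_1 => eW i))
  (* a i k and b i k, for 1 <= k <= m, are the coefficients of z^(-k) dz *)
  (a b : 'I_r -> nat -> RR[i])
  (haV : forall i, induced_connection nablaV (eV i) =
    tens (eV i) (\sum_(1 <= k < m.+1)
                   tps_const _ (a i k) *: polar_dz RR[i] (r ^ 2 * m) m k))
  (hbW : forall i, induced_connection nablaW (eW i) =
    tens (eW i) (\sum_(1 <= k < m.+1)
                   tps_const _ (b i k) *: polar_dz RR[i] (r ^ 2 * m) m k))
  (hRea : forall i, 0 <= complex.Re (a i 1%N) < 1)
  (hReb : forall i, 0 <= complex.Re (b i 1%N) < 1)
  (phi : {linear V -> W}) (phi_bij : bijective phi)
  (phi_nabla : forall v, nablaW (phi v) = twist_map phi (nablaV v)) :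
  exists sigma : 'S_r, forall (i : 'I_r) (k : nat), (1 <= k <= m)%N ->
    a i k = b (sigma i) k.
Proof.
set N := (r ^ 2 * m)%N in V W hV hW nablaV nablaW cV cW FV FW FV0 FW0 FVr FWr
  FVS FWS grV grW stV stW eV eW beV beW haV hbW phi phi_bij phi_nabla.
have N_gt0 : (0 < N)%N by rewrite muln_gt0 expn_gt0 hr.
(* The given sum of [polar_dz] terms is [polar] by unfolding, as scaling in [form] is ring
   multiplication. *)
have [v [A [spanV freeV nV At Ad]]] := triangular_frame cV FV0 FVr FVS stV
  (p := fun i => polar N m (a i)) beV haV.
have [w [B [spanW freeW nW Bt Bd]]] := triangular_frame cW FW0 FWr FWS stW
  (p := fun i => polar N m (b i)) beW hbW.
have eqW (c c' : 'I_r -> tps RR[i] N) :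
    \sum_i c i *: w i = \sum_i c' i *: w i -> c =1 c'.
  move=> eq_cc i; apply/eqP; rewrite -subr_eq0; apply/eqP.
  apply: (freeW (fun i => c i - c' i)).
  under eq_bigr => k _ do rewrite scalerBl.
  by rewrite sumrB eq_cc subrr.
have [psi phiK psiK] := phi_bij.
have [P PE] := choice (fun i => spanW (phi (v i))).
have [Q QE] := choice (fun j => spanV (psi (w j))).
pose Pm : 'M_r := \matrix_(k, i) P i k; pose Qm : 'M_r := \matrix_(i, j) Q j i.
have phi_sum (c : 'I_r -> tps RR[i] N) :
    phi (\sum_i c i *: v i) = \sum_k (\sum_i Pm k i * c i) *: w k.
  rewrite linear_sum /=.
  under eq_bigr => i _ do rewrite linearZ /= PE scaler_sumr.
  rewrite exchange_big; apply: eq_bigr => k _; rewrite scaler_suml.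
  by apply: eq_bigr => i _; rewrite mxE scalerA mulrC.
have QP : Qm *m Pm = 1%:M.
  apply: mulmx1C; apply/matrixP => k j; rewrite !mxE.
  have := @eqW (fun k => \sum_i Pm k i * Q j i) (fun k => (k == j)%:R).
  move=> /(_ _ k) <-; first by apply: eq_bigr => i _; rewrite !mxE.
  rewrite -phi_sum -QE psiK (bigD1 j) //= eqxx scale1r big1 ?addr0 // => i /negbTE ->.
  by rewrite scale0r.
(* Expand [nablaW (phi (v i)) = phi (nablaV (v i))] in the frame [w] and compare coefficients. *)
have eqBPA : map_mx (fun x : tps RR[i] N => tps_d m x : tps RR[i] N) Pm + B *m Pm = Pm *m A.
  apply/matrixP => k i; rewrite !mxE.
  have := phi_nabla (v i); rewrite /twist_map nV phi_sum PE (connection_sum cW).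
  under eq_bigr => j _ do rewrite nW scaler_sumr.
  rewrite big_split exchange_big /= -big_split /=.
  under eq_bigr => j _.
    under [X in _ + X]eq_bigr do rewrite scalerA.
    rewrite -scaler_suml -scalerDl; over.
  move=> /eqW/(_ k) <-; congr (_ + _).
  by apply: eq_bigr => j _; rewrite mxE mulrC.
have res i k n : (0 < n)%N -> b k 1%N - a i 1%N + n%:R != 0.
  by have /andP[? _] := hReb k; have /andP[_ ?] := hRea i; apply: residue_shift_neq0.
have coef0_1 : ((1 : tps RR[i] N) : {poly RR[i]})`_0 = 1.
  by rewrite -in_qpoly1 in_qpolyXN // N_gt0 coef1.
(* The truncation order [r^2 m] exceeds the total loss [r^2 (m - 1)], so the constant term of [1] is
   still seen. *)
have Epos : (0 < N - (0 + r * r * m.-1))%N.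
  by rewrite subn_gt0 /N -mulnn ltn_pmul2l ?muln_gt0 ?hr // prednK.
have [||||sigma sE] := @triangular_matching _ _ (tps_dD m) (tps_dM N_gt0 hm) _ m.-1
  (@vanishes0 _ N) (@vanishesD _ _) (vanishesM N_gt0) (@vanishes_mono _ _)
  r 0 A B Pm Qm
  (fun i => polar N m (a i)) (fun i => polar N m (b i)) _ At Ad _ _ _ QP eqBPA.
- move=> /(_ 0%N); rewrite coef0_1 => one0; have /eqP := one0 Epos.
  by rewrite oner_eq0.
- by move=> i k /Bt ->; apply: vanishes0.
- by move=> i; rewrite Bd subrr; apply: vanishes0.
- by move=> i k; apply: (polar_dichotomy N_gt0 hm) => n; apply: res.
exists sigma => i k /andP[k_gt0 le_km].
have lt_m : (m - k < m)%N by rewrite ltn_subrL k_gt0.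
have lt_N : (m - k < N)%N by rewrite (leq_trans lt_m) // leq_pmull // expn_gt0 hr.
(* The coefficient of [z^(-k) dz] sits in degree [m - k], below both [m] and [N]. *)
have := congr1 (fun x : tps RR[i] N => (x : {poly RR[i]})`_(m - k)) (sE i).
by rewrite /= !polar_coef // lt_m subKn.
Qed.
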